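(* For every fixed $x_0$, the conditional Gaussian path $p_t(x\mid x_0)=\mathcal{N}(x;\alpha_t x_0,\sigma_t^2 I)$ is generated by the ODE $$\frac{\mathrm{d}X_t}{\mathrm{d}t}=u_t(X_t\mid x_0),$$ with velocity field $$u_t(x\mid x_0):=\left(\dot\alpha_t-\frac{\dot\sigma_t}{\sigma_t}\alpha_t\right)x_0+\frac{\dot\sigma_t}{\sigma_t}x .$$ Equivalently, the conditional density satisfies the conditional continuity equation $$\partial_t p_t(x\mid x_0)=-\nabla\cdot\bigl(p_t(x\mid x_0)\,u_t(x\mid x_0)\bigr).$$
   Context: Here $x,x_0\in\mathbb{R}^d$ and $t\in[0,1]$. The schedules $\alpha_t,\sigma_t$ are differentiable functions of $t$ with $\alpha_0=1$, $\alpha_1=0$, $\sigma_0=0$, $\sigma_1=1$, $\alpha_t\ge0$ and $\sigma_t\ge0$ for all $t\in[0,1]$, and $\frac{\mathrm{d}}{\mathrm{d}t}\sigma_t^2-2\frac{\dot\alpha_t}{\alpha_t}\sigma_t^2\ge 0$; a dot denotes $\mathrm{d}/\mathrm{d}t$. $\mathcal{N}(x;m,\Sigma)$ is the density at $x$ of the Gaussian with mean $m$ and covariance $\Sigma$. The conditional path is the family of laws of $X_t\mid X_0=x_0$, where $X_t=\alpha_tX_0+\sigma_t\varepsilon$ with $\varepsilon\sim\mathcal{N}(0,I)$. That the path is generated by the ODE means that $X_t$ evolving by the ODE has density $p_t(\cdot\mid x_0)$. Divergence is with respect to $x$. *)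

(* Defs.v *)
From HB Require Import structures.
From mathcomp Require Import all_boot all_order all_algebra.
From mathcomp Require Import all_classical all_reals all_analysis.
Import Order.TTheory GRing.Theory Num.Theory.
Import numFieldTopology.Exports numFieldNormedType.Exports.

Set Implicit Arguments.
Unset Strict Implicit.
Unset Printing Implicit Defensive.

Local Open Scope classical_set_scope.
Local Open Scope ring_scope.

Definition measure_rV_display : measure_display -> measure_display.
Proof. exact. Qed.

(* The sigma-algebra on row vectors generated by the coordinates; for
   real-valued entries it is the Borel sigma-algebra of R^n. *)
Section measurable_rV.
Context {d : measure_display} {T : measurableType d} (n : nat).

Definition rV_coord (i : 'I_n) (v : 'rV[T]_n) : T := v ord0 i.

Let rV_set0 : g_sigma_preimage rV_coord set0.
Proof. exact: sigma_algebra0. Qed.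

Let rV_setC A : g_sigma_preimage rV_coord A ->
  g_sigma_preimage rV_coord (~` A).
Proof. exact: sigma_algebraC. Qed.

Let rV_bigcup (F : (set 'rV[T]_n)^nat) :
  (forall i, g_sigma_preimage rV_coord (F i)) ->
  g_sigma_preimage rV_coord (\bigcup_i (F i)).
Proof. exact: sigma_algebra_bigcup. Qed.

HB.instance Definition _ := @isMeasurable.Build (measure_rV_display d)
  'rV[T]_n (g_sigma_preimage rV_coord) rV_set0 rV_setC rV_bigcup.

Lemma measurable_rV_coord (i : 'I_n) : measurable_fun setT (rV_coord i).
Proof.
move=> _ Y mY; rewrite setTI; apply: sub_sigma_algebra => /=.
rewrite -bigcup_seq/=; exists i => /=; first by rewrite mem_index_enum.
by exists Y => //; rewrite setTI.
Qed.

Lemma measurable_fun_rV d' (U : measurableType d') (f : U -> 'rV[T]_n) :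
  (forall i, measurable_fun setT (rV_coord i \o f)) -> measurable_fun setT f.
Proof.
move=> mf; have sub : g_sigma_preimage rV_coord `<=`
    [set A : set 'rV[T]_n | measurable (f @^-1` A)].
  apply: smallest_sub.
    split => /=.
    - by rewrite preimage_set0.
    - by move=> A mA; rewrite setTD preimage_setC; exact: measurableC.
    - by move=> F mF; rewrite preimage_bigcup; exact: bigcup_measurable.
  rewrite -bigcup_seq/= => _ [i _ [B mB <-]] /=.
  by have := mf i measurableT B mB; rewrite !setTI.
by move=> _ A mA; rewrite setTI; exact: sub.
Qed.

End measurable_rV.

Section lebesgue_rV.
Variable R : realType.

Definition rV_cons n (p : measurableTypeR R * 'rV[R]_n) : 'rV[R]_n.+1 :=
  \row_i oapp (fun j => p.2 ord0 j) p.1 (unlift ord0 i).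

Definition rV_uncons n (v : 'rV[R]_n.+1) : measurableTypeR R * 'rV[R]_n :=
  (v ord0 ord0, \row_j v ord0 (lift ord0 j)).

Lemma rV_consK n : cancel (@rV_cons n) (@rV_uncons n).
Proof.
move=> [x v]; rewrite /rV_uncons /rV_cons; congr pair.
  by rewrite mxE unlift_none.
by apply/rowP => j; rewrite !mxE liftK.
Qed.

Lemma rV_unconsK n : cancel (@rV_uncons n) (@rV_cons n).
Proof.
by move=> v; apply/rowP => i; rewrite mxE; case: unliftP => [j|] -> //=;
  rewrite mxE.
Qed.

Lemma measurable_rV_cons n : measurable_fun setT (@rV_cons n).
Proof.
apply: measurable_fun_rV => i.
case: (unliftP ord0 i) => [j|] ->.
- rewrite (_ : _ \o _ = @rV_coord _ _ n j \o snd).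
    by apply: measurableT_comp; [exact: measurable_rV_coord|exact: measurable_snd].
  by apply/funext => -[x v]; rewrite /rV_coord /= mxE liftK.
- rewrite (_ : _ \o _ = fst); first exact: measurable_fst.
  by apply/funext => -[x v]; rewrite /rV_coord /= mxE unlift_none.
Qed.

HB.instance Definition _ n :=
  @isMeasurableFun.Build _ _ _ _ (@rV_cons n) (@measurable_rV_cons n).

Lemma measurable_rV_uncons n : measurable_fun setT (@rV_uncons n).
Proof.
apply: measurable_fun_pair; first exact: (measurable_rV_coord ord0).
apply: measurable_fun_rV => i.
rewrite (_ : _ \o _ = @rV_coord _ _ n.+1 (lift ord0 i)).
  exact: measurable_rV_coord.
by apply/funext => v; rewrite /rV_coord /= mxE.
Qed.

Section next.
Context (l : {sigma_finite_measure set (measurableTypeR R) -> \bar R})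
  (n : nat) (m : {sigma_finite_measure set 'rV[R]_n -> \bar R}).

Definition rV_product : set 'rV[R]_n.+1 -> \bar R :=
  pushforward (l \x m)%E (@rV_cons n).

Let next0 : rV_product set0 = 0%E.
Proof. exact: measure0. Qed.

Let next_ge0 A : (0 <= rV_product A)%E.
Proof. exact: measure_ge0. Qed.

Let next_sigma_additive : semi_sigma_additive rV_product.
Proof. exact: measure_semi_sigma_additive. Qed.

HB.instance Definition _ := isMeasure.Build _ _ _ rV_product
  next0 next_ge0 next_sigma_additive.

Lemma rV_product_sigma_finite : sigma_finite setT rV_product.
Proof.
have /sigma_finiteP[F [FT ndF Foo]] := sigma_finiteT l.
have /sigma_finiteP[G [GT ndG Goo]] := sigma_finiteT m.
exists (fun k => @rV_uncons n @^-1` (F k `*` G k)).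
  rewrite -preimage_bigcup (_ : \bigcup_k _ = setT) ?preimage_setT//.
  apply/seteqP; split=> // -[x v] _.
  have [i _ Fix] : (\bigcup_k F k) x by rewrite -FT.
  have [j _ Gjv] : (\bigcup_k G k) v by rewrite -GT.
  exists (maxn i j) => //; split.
    by move: x Fix; exact/subsetPset/ndF/leq_maxl.
  by move: v Gjv; exact/subsetPset/ndG/leq_maxr.
move=> k; have [mF Fk] := Foo k; have [mG Gk] := Goo k; split.
  rewrite -[X in measurable X]setTI; apply: measurable_rV_uncons => //.
  exact: measurableX.
rewrite /rV_product /pushforward -comp_preimage.
rewrite (_ : _ \o _ = id); last by apply/funext => p /=; exact: rV_consK.
by rewrite product_measure1E// lte_mul_pinfty// ge0_fin_numE.
Qed.

HB.instance Definition _ := @Measure_isSigmaFinite.Build _ _ _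
  rV_product rV_product_sigma_finite.

End next.

(* Lebesgue measure on the Borel sets of R^n, as an iterated product of the
   one-dimensional one. *)
Fixpoint lebesgue_rV (n : nat) : {sigma_finite_measure set 'rV[R]_n -> \bar R} :=
  if n is k.+1 then rV_product lebesgue_measure (lebesgue_rV k) else \d_(0 : 'rV[R]_0).

Lemma lebesgue_rV_box n (A : 'I_n -> set R) :
  (forall i, measurable (A i)) ->
  lebesgue_rV n [set v | forall i, A i (v ord0 i)] =
  (\prod_(i < n) lebesgue_measure (A i))%E.
Proof.
elim: n A => [|n IH] A mA /=.
  rewrite big_ord0 diracE mem_set// => -[].
  by case.
rewrite big_ord_recl -IH; last by [].
pose B : set 'rV[R]_n := [set v | forall i, A (lift ord0 i) (v ord0 i)].
have mB : measurable B.
  have -> : B = \bigcap_(i in [set: 'I_n]) (rV_coord i @^-1` A (lift ord0 i)).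
    by apply/seteqP; split => v /= Bv i; [move=> _|]; apply: Bv.
  apply: fin_bigcap_measurable => // i _.
  by rewrite -[X in measurable X]setTI; exact: measurable_rV_coord.
rewrite -product_measure1E; [|exact: mA|exact: mB].
rewrite /rV_product /pushforward.
congr (product_measure1 _ _ _); apply/seteqP; split => -[x v] /=.
  move=> h; split; first by have := h ord0; rewrite mxE unlift_none.
  by move=> i; have := h (lift ord0 i); rewrite mxE liftK.
by move=> [h0 h] i; rewrite mxE; case: unliftP => [j|] -> /=.
Qed.

End lebesgue_rV.

Section derive_within.
Context {R : realType} {V : normedModType R}.
Implicit Types (I : set R) (f : R -> V) (t : R).

(* Derivatives along a set of times I: one-sided at an endpoint of I. *)
Definition diff_quotient f t (s : R) : V := (s - t)^-1 *: (f s - f t).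

Definition is_derive_within I f t (l : V) : Prop :=
  diff_quotient f t @ within I t^' --> l.

Definition derivable_within I f t : Prop :=
  cvg (diff_quotient f t @ within I t^').

Definition derive_within I f t : V :=
  lim (diff_quotient f t @ within I t^').

End derive_within.

Section density.
Context {R : realType} {n : nat}.

Definition gauss_pdf (m : 'rV[R]_n) (S : 'M[R]_n) (x : 'rV[R]_n) : R :=
  (Num.sqrt ((2 * pi) ^+ n * \det S))^-1 *
  expR (- ((x - m) *m invmx S *m (x - m)^T) ord0 ord0 / 2).

Context {d : measure_display} {T : measurableType d} (P : probability T R).
Implicit Types X Y : T -> 'rV[R]_n.

Definition has_density X (f : 'rV[R]_n -> R) : Prop :=
  measurable_fun setT X /\
  forall A, measurable A ->
    P (X @^-1` A) = (\int[lebesgue_rV R n]_(x in A) (f x)%:E)%E.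

Definition independent_vectors X Y : Prop :=
  forall A B, measurable A -> measurable B ->
    P (X @^-1` A `&` Y @^-1` B) = (P (X @^-1` A) * P (Y @^-1` B))%E.

(* [f y] is the density of the conditional law of [Y] given [X = y]. *)
Definition has_cond_density X Y (f : 'rV[R]_n -> 'rV[R]_n -> R) : Prop :=
  measurable_fun setT Y /\
  forall A B, measurable A -> measurable B ->
    P (X @^-1` A `&` Y @^-1` B) =
    (\int[P]_(w in X @^-1` A) \int[lebesgue_rV R n]_(y in B) (f (X w) y)%:E)%E.

End density.

Section transport.
Context {R : realType} {n : nat}.
Implicit Types (I J : set R) (u : R -> 'rV[R]_n -> 'rV[R]_n)
  (p : R -> 'rV[R]_n -> R).

Definition solves_ode J u (x : R -> 'rV[R]_n) : Prop :=
  forall t, J t -> is_derive_within J x t (u t (x t)).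

(* On every time interval J included in I, the ODE has a solution through each
   point at each time, and any process evolving by the ODE that has density
   p_s at one time s of J has density p_t at every time t of J. *)
Definition generated_by_ode I u p : Prop :=
  forall J, is_interval J -> J `<=` I -> forall s, J s ->
    (forall y, exists2 x, solves_ode J u x & x s = y) /\
    (forall (d : measure_display) (T : measurableType d)
        (P : probability T R) (X : R -> T -> 'rV[R]_n),
      (forall w, solves_ode J u (X ^~ w)) -> has_density P (X s) (p s) ->
      forall t, J t -> has_density P (X t) (p t)).

Definition divergence (F : 'rV[R]_n -> 'rV[R]_n) (x : 'rV[R]_n) : R :=
  \sum_(i < n) 'D_(delta_mx ord0 i) (fun y => F y ord0 i) x.

(* At the times of I, with the time derivative taken within [0, 1]. *)
Definition continuity_equation I u p : Prop :=
  forall t x, I t ->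
    differentiable (fun y => p t y *: u t y) x /\
    is_derive_within `[0, 1] (p ^~ x) t
      (- divergence (fun y => p t y *: u t y) x).

End transport.

Section gaussian_path.
Context {R : realType}.
Implicit Types alpha sigma : R -> R.

(* The quotient alpha'/alpha in the last condition only makes sense where
   alpha does not vanish; alpha 1 = 0. *)
Record is_schedule alpha sigma : Prop := IsSchedule {
  schedule_derivable_alpha : forall t, t \in `[0, 1] ->
    derivable_within `[0, 1] alpha t ;
  schedule_derivable_sigma : forall t, t \in `[0, 1] ->
    derivable_within `[0, 1] sigma t ;
  schedule_alpha0 : alpha 0 = 1 ;
  schedule_alpha1 : alpha 1 = 0 ;
  schedule_sigma0 : sigma 0 = 0 ;
  schedule_sigma1 : sigma 1 = 1 ;
  schedule_alpha_ge0 : forall t, t \in `[0, 1] -> 0 <= alpha t ;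
  schedule_sigma_ge0 : forall t, t \in `[0, 1] -> 0 <= sigma t ;
  schedule_diffusion_ge0 : forall t, t \in `[0, 1] -> alpha t != 0 ->
    0 <= derive_within `[0, 1] (fun s => sigma s ^+ 2) t
         - 2 * (derive_within `[0, 1] alpha t / alpha t) * sigma t ^+ 2 }.

(* The times at which the covariance sigma_t^2 I is invertible: elsewhere
   (for instance at t = 0) the path has no density and u_t is undefined. *)
Definition nondegenerate_times sigma : set R :=
  [set t | t \in `[0, 1] /\ 0 < sigma t].

Context {n : nat}.

Definition cond_path alpha sigma (x0 : 'rV[R]_n) (t : R) : 'rV[R]_n -> R :=
  gauss_pdf (alpha t *: x0) (sigma t ^+ 2)%:M.

Definition cond_velocity alpha sigma (x0 : 'rV[R]_n) (t : R) (x : 'rV[R]_n) :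
    'rV[R]_n :=
  let dalpha := derive_within `[0, 1] alpha t in
  let dsigma := derive_within `[0, 1] sigma t in
  (dalpha - dsigma / sigma t * alpha t) *: x0 + (dsigma / sigma t) *: x.

End gaussian_path.

(* Main.v *)
From HB Require Import structures.
Require Import Defs.
From mathcomp Require Import all_boot all_order all_algebra.
From mathcomp Require Import all_classical all_reals all_analysis.
From mathcomp Require Import measurable_realfun ring.
Import Order.TTheory GRing.Theory Num.Theory.
Import numFieldTopology.Exports numFieldNormedType.Exports.

Set Implicit Arguments.
Unset Strict Implicit.
Unset Printing Implicit Defensive.

Local Open Scope classical_set_scope.
Local Open Scope ring_scope.

(* Along any solution of the ODE, (x_t - alpha_t x0) / sigma_t has zero
   derivative, so the flow from time s to time t is the affine map
   y |-> alpha_t x0 + (sigma_t / sigma_s) (y - alpha_s x0), which carries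
   N(alpha_s x0, sigma_s^2 I) to N(alpha_t x0, sigma_t^2 I) by the change of
   variables formula.  In the continuity equation, with z = x - alpha_t x0 and
   k = sigma_t' / sigma_t, both sides are p_t(x | x0) times
   - n k + k |z|^2 / sigma_t^2 + alpha_t' <z, x0> / sigma_t^2.  The conditional
   law of X_t is obtained by sections, the joint law of (X_0, eps) being the
   product of the marginals. *)

(** * Calculus of derivatives along a set of times *)

Section derive_within_theory.
Context {R : realType}.
Implicit Types (I J : set R) (t : R).

#[local] Instance within_dnbhs_filter I t : Filter (within I t^').
Proof. exact: within_filter. Qed.

Let dnbhs_neq t : \forall s \near t^', s != t.
Proof. exact: withinT. Qed.

Lemma is_derive_within_subset {V : normedModType R} I J (f : R -> V) t l :
  J `<=` I -> is_derive_within I f t l -> is_derive_within J f t l.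
Proof.
move=> JI; apply: cvg_trans; apply: cvg_app.
by apply: within_subset => //; exact: dnbhs_filter.
Qed.

(** Away from [t], [f s] equals [(s - t) *: diff_quotient f t s + f t], and the first term tends to
    [0 *: l]. *)
Lemma is_derive_within_cvg {V : normedModType R} I (f : R -> V) t l :
  is_derive_within I f t l -> f s @[s --> within I t^'] --> f t.
Proof.
move=> dft.
have st : (s - t) @[s --> within I t^'] --> 0.
  rewrite -(subrr t); apply: cvgB; last exact: cvg_cst.
  by apply: cvg_trans (@nbhs_dnbhs _ t); apply: cvg_within; exact: dnbhs_filter.
have H : (s - t) *: diff_quotient f t s + f t @[s --> within I t^'] --> f t.
  rewrite -[X in _ --> X]add0r -(scale0r l).
  by apply: cvgD; [exact: cvgZ|exact: cvg_cst].
apply: cvg_trans H; apply: near_eq_cvg.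
near=> s; rewrite /= /diff_quotient.
rewrite scalerA divff ?scale1r ?subrK// subr_eq0.
near: s; apply: cvg_within; exact: dnbhs_neq.
Unshelve. all: by end_near. Qed.

Lemma is_derive_within_cst {V : normedModType R} I (k : V) t :
  is_derive_within I (fun=> k) t 0.
Proof.
rewrite /is_derive_within (_ : diff_quotient _ _ = cst 0); first exact: cvg_cst.
by apply/funext => s; rewrite /diff_quotient subrr scaler0.
Qed.

Lemma is_derive_withinD {V : normedModType R} I (f g : R -> V) t df dg :
  is_derive_within I f t df -> is_derive_within I g t dg ->
  is_derive_within I (fun s => f s + g s) t (df + dg).
Proof.
move=> fd gd; rewrite /is_derive_within.
rewrite (_ : diff_quotient _ _ =
  fun s => diff_quotient f t s + diff_quotient g t s); first exact: cvgD.
by apply/funext => s; rewrite /diff_quotient -scalerDr opprD addrACA.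
Qed.

(** The increment splits as [(k s - k t) *: f s + k t *: (f s - f t)]; the factor [f s] is what
    calls for continuity of [f] at [t] along [I]. *)
Lemma is_derive_withinZ {V : normedModType R} I (k : R -> R) (f : R -> V) t dk df :
  is_derive_within I k t dk -> is_derive_within I f t df ->
  is_derive_within I (fun s => k s *: f s) t (dk *: f t + k t *: df).
Proof.
move=> kd fd; rewrite /is_derive_within.
rewrite (_ : diff_quotient _ _ =
  fun s => diff_quotient k t s *: f s + k t *: diff_quotient f t s).
  apply: cvgD; first exact: cvgZ kd (is_derive_within_cvg fd).
  exact: cvgZ (cvg_cst _) fd.
apply/funext => s; rewrite /diff_quotient -[_ *: (k s - k t)]/(_ * _).
rewrite (scalerA (k t)) [k t * _]mulrC -!scalerA -scalerDr.
by congr (_ *: _); rewrite scalerBr scalerBl addrA subrK.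
Qed.

Lemma is_derive_withinM I (f g : R -> R) t df dg :
  is_derive_within I f t df -> is_derive_within I g t dg ->
  is_derive_within I (fun s => f s * g s) t (df * g t + f t * dg).
Proof. exact: is_derive_withinZ. Qed.

Lemma is_derive_withinX I (f : R -> R) t df n :
  is_derive_within I f t df ->
  is_derive_within I (fun s => f s ^+ n) t (n%:R * f t ^+ n.-1 * df).
Proof.
move=> fd; elim: n => [|n IH].
  by rewrite !mul0r; exact: is_derive_within_cst.
rewrite (_ : (fun s => _) = fun s => f s * f s ^+ n); last first.
  by apply/funext => s; rewrite exprS.
rewrite (_ : _ * df = df * f t ^+ n + f t * (n%:R * f t ^+ n.-1 * df)).
  exact: is_derive_withinM.
(* The case [n = 0] is apart because [n.-1] is truncated there; the coefficient [0%:R] then removes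
   the term. *)
case: n {IH} => [|n] /=; first by rewrite expr0; ring.
by rewrite exprS -natr1; ring.
Qed.

(* Caratheodory's slope function: it turns the limit of the difference quotient
   into continuity at t, so that it can be composed. *)
Let dq (f : R -> R) t l s := if s == t then l else diff_quotient f t s.

Let dq_continuous f t l :
  diff_quotient f t @ t^' --> l <-> {for t, continuous (dq f t l)}.
Proof.
rewrite continuous_withinNx {2}/dq eqxx.
split; apply: cvg_trans; apply: near_eq_cvg; near=> s; rewrite /dq ifN//;
  near: s; exact: dnbhs_neq.
Unshelve. all: by end_near. Qed.

(** Bridge to the usual derivative: the shift [s = h + t] turns one difference quotient into the
    other, and the slope function lets this shift be made as a statement of continuity. *)
Lemma is_derive_withinT (f : R -> R) t l :
  is_derive_within setT f t l <-> is_derive t 1 f l.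
Proof.
rewrite /is_derive_within withinET dq_continuous -continuous_withinNshiftx.
rewrite {2}/dq eqxx.
have E : \forall h \near 0^', (dq f t l \o shift t) h =
    h^-1 *: ((f \o shift t) (h *: 1) - f t).
  near=> h; rewrite /dq /= /diff_quotient [h *: 1]mulr1 addrK ifN//.
  rewrite -subr_eq0 addrK; near: h; exact: dnbhs_neq.
split => [cf|[df fl]].
  have cf' : h^-1 *: ((f \o shift t) (h *: 1) - f t) @[h --> 0^'] --> l.
    by move: cf; apply: cvg_trans; exact: near_eq_cvg.
  split; first by apply/cvg_ex; exists l.
  exact/cvg_lim.
rewrite -fl; apply: cvg_trans df; apply: near_eq_cvg.
by apply: filterS E => h E; rewrite fl E.
Unshelve. all: by end_near. Qed.

Lemma is_derive_within_comp I (f g : R -> R) t df dg :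
  is_derive_within I f t df -> is_derive (f t) 1 g dg ->
  is_derive_within I (g \o f) t (dg * df).
Proof.
move=> fd gd.
rewrite /is_derive_within.
(* With the slope function of [g] this factorization holds even at times where [f s = f t], since
   both sides are then 0. *)
rewrite (_ : diff_quotient _ _ = fun s => dq g (f t) dg (f s) * diff_quotient f t s).
  suff : dq g (f t) dg (f s) @[s --> within I t^'] --> (dg : R).
    by move=> H; exact: (cvgM H fd).
  rewrite -[X in _ --> X](_ : dq g (f t) dg (f t) = dg); last by rewrite /dq eqxx.
  apply: continuous_cvg; last exact: is_derive_within_cvg fd.
  by apply/dq_continuous; move/is_derive_withinT: gd;
  rewrite /is_derive_within withinET.
apply/funext => s; rewrite /diff_quotient /dq /=.
case: ifPn => [/eqP ->|ne]; first by rewrite !subrr !scaler0 mulr0.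
rewrite /diff_quotient /GRing.scale/= [RHS]mulrCA; congr (_ * _).
by rewrite mulrAC mulVf ?subr_eq0// mul1r.
Qed.

Lemma is_derive_within_sum {V : normedModType R} {J : Type} (r : seq J) I
    (f : J -> R -> V) t df :
  (forall i, is_derive_within I (f i) t (df i)) ->
  is_derive_within I (fun s => \sum_(i <- r) f i s) t (\sum_(i <- r) df i).
Proof.
move=> fd; elim: r => [|i r IH].
  rewrite big_nil (_ : (fun s => _) = fun=> 0); first exact: is_derive_within_cst.
  by apply/funext => s; rewrite big_nil.
rewrite big_cons (_ : (fun s => _) = fun s => f i s + \sum_(j <- r) f j s).
  exact: is_derive_withinD.
by apply/funext => s; rewrite big_cons.
Qed.

Lemma eq_is_derive_within {V : normedModType R} I (f g : R -> V) t l :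
  I t -> (forall s, I s -> f s = g s) ->
  is_derive_within I f t l -> is_derive_within I g t l.
Proof.
move=> It fg; apply: cvg_trans; apply: near_eq_cvg.
have : \forall s \near within I t^', I s by exact: withinT.
by apply: filterS => s Is; rewrite /diff_quotient !fg.
Qed.

(** Reduces a directional derivative in space to a derivative in one real variable, so that the
    rules above also serve for the divergence. *)
Lemma is_derive_line {V W : normedModType R} (f : V -> W) x v l :
  is_derive_within setT (fun h => f (h *: v + x)) 0 l -> is_derive x v f l.
Proof.
rewrite /is_derive_within withinET (_ : diff_quotient _ _ =
  fun h => h^-1 *: ((f \o shift x) (h *: v) - f x)) => [fl|]; last first.
  by apply/funext => h; rewrite /diff_quotient subr0 scale0r add0r.
by split; [apply/cvg_ex; exists l|exact/cvg_lim].
Qed.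

Lemma is_derive_withinV I (f : R -> R) t df : f t != 0 ->
  is_derive_within I f t df ->
  is_derive_within I (fun s => (f s)^-1) t (- (f t) ^- 2 * df).
Proof.
move=> ft fd; apply: (is_derive_within_comp (g := @GRing.inv R)) => //.
have := @is_deriveV R id (f t) 1 1 ft (is_derive_id _ _).
by rewrite [_ *: _]mulr1.
Qed.

Lemma is_derive_within_coord n I (f : R -> 'rV[R]_n) t l i :
  is_derive_within I f t l ->
  is_derive_within I (fun s => f s ord0 i) t (l ord0 i).
Proof.
move=> fd; rewrite /is_derive_within.
rewrite (_ : diff_quotient _ _ =
  (fun v : 'rV[R]_n => v ord0 i) \o diff_quotient f t).
  by apply: continuous_cvg fd; exact: coord_continuous.
by apply/funext => s; rewrite /diff_quotient /= !mxE.
Qed.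

(** The mean value theorem on [[s, t]]. This is what gives uniqueness of solutions of the ODE. *)
Lemma is_derive_within0_cst J (f : R -> R) : is_interval J ->
  (forall t, J t -> is_derive_within J f t 0) ->
  forall s t, J s -> J t -> f s = f t.
Proof.
move=> Jitv fd; suff H s t : J s -> J t -> s < t -> f s = f t.
  move=> s t Js Jt; have [st|ts|->//] := ltgtP s t; first exact: H.
  by apply/esym; exact: H.
move=> Js Jt st.
have Jc c : s <= c <= t -> J c by exact: Jitv.
(* An interior point [c] has a neighbourhood inside [J], so the limit along [J] is the two-sided
   one. At [s] and [t] only one-sided continuity is needed. *)
have drv c : c \in `]s, t[ -> is_derive c 1 f 0.
  rewrite in_itv/= => /andP[sc ct].
  have := fd c (Jc c _); rewrite !ltW// => /(_ isT) dc.
  apply/is_derive_withinT; rewrite /is_derive_within withinET.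
  apply: cvg_trans dc => A; rewrite /= !nbhs_filterE /fmap/= => dA.
  have cJ : \forall x \near c, J x.
    have : \forall x \near c, x \in `]s, t[.
      by apply: near_in_itvoo; rewrite in_itv/= sc.
    apply: filterS => x; rewrite in_itv/= => /andP[sx xt].
    by apply: Jc; rewrite !ltW.
  by apply: filterS2 cJ dA => x /= Jx + xc; exact.
have cf : {within `[s, t], continuous f}.
  apply/continuous_within_itvP => //; split.
  - by move=> c /drv [/derivable1_diffP/differentiable_continuous].
  - apply: cvg_trans (is_derive_within_cvg (fd s Js)) => A /=.
    rewrite !nbhs_filterE /fmap/= => fA.
    have ts : \forall x \near s, x < t by exact: lt_nbhsl.
    apply: filterS2 ts fA => x /= xt + sx; apply; first by rewrite gt_eqF.
    by apply: Jc; rewrite !ltW.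
  - apply: cvg_trans (is_derive_within_cvg (fd t Jt)) => A /=.
    rewrite !nbhs_filterE /fmap/= => fA.
    have ts : \forall x \near t, s < x by exact: lt_nbhsr.
    apply: filterS2 ts fA => x /= xt + sx; apply; first by rewrite lt_eqF.
    by apply: Jc; rewrite !ltW.
have [c _ /eqP] := MVT st drv cf.
by rewrite mul0r subr_eq0 => /eqP.
Qed.

End derive_within_theory.

(** Provides the image measure as an abstract measure known through its values only, ready for the
    uniqueness theorems for Lebesgue and product measures. *)
Lemma measure_image {d d' : measure_display} {T : measurableType d}
    {T' : measurableType d'} {R : realFieldType}
    (m : {measure set T -> \bar R}) (f : T -> T') :
  measurable_fun setT f ->
  exists m' : {measure set T' -> \bar R}, forall A, m' A = m (f @^-1` A).
Proof. by move=> mf; unshelve eexists (pushforward m f). Qed.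

(** * Lebesgue measure and integrals under affine maps *)

Section affine_change_of_variables.
Context {R : realType}.
Implicit Types (c : R).

Local Notation leb := (@lebesgue_measure R).

Lemma affine_preimage_itv (a c x y : R) : 0 < c ->
  (fun e : R => a + c * e) @^-1` `]x, y] =
  `](x - a) / c, (y - a) / c]%classic.
Proof.
move=> c0; apply/seteqP; split => e /=; rewrite !in_itv/=.
  by rewrite ltr_pdivrMr// ler_pdivlMr// ltrBlDl lerBrDl [e * c]mulrC.
by rewrite ltr_pdivrMr// ler_pdivlMr// ltrBlDl lerBrDl [e * c]mulrC.
Qed.

Lemma measurable_affine (a c : R) :
  measurable_fun setT (fun e : R => a + c * e).
Proof. by apply: measurable_funD => //; exact: measurable_funM. Qed.

Lemma measurable_affine_rV n (a : 'rV[R]_n) c :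
  measurable_fun setT (fun e : 'rV[R]_n => a + c *: e).
Proof.
apply: measurable_fun_rV => i.
rewrite (_ : _ \o _ = (fun e : R => a ord0 i + c * e) \o rV_coord i).
  by apply: measurableT_comp; [exact: measurable_affine|exact: measurable_rV_coord].
by apply/funext => v; rewrite /rV_coord /= !mxE.
Qed.

Local Open Scope ereal_scope.

(** The image measure scaled by [c] gives each half-open interval its length, which characterizes
    Lebesgue measure. *)
Lemma lebesgue_measure_affine (a c : R) (A : set R) : (0 < c)%R ->
  measurable A ->
  c%:E * leb ((fun e : R => a + c * e)%R @^-1` A) = leb A.
Proof.
move=> c0 mA.
have mphi : measurable_fun setT
  (fun e : measurableTypeR R => a + c * e : measurableTypeR R)%R.
  exact: measurable_affine.
have [m mE] := measure_image leb mphi.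
have -> : leb A = mscale (NngNum (ltW c0)) m A; last first.
  by rewrite /mscale/= mE.
apply: lebesgue_measure_unique => // _ [[x y] _ <-] /=.
rewrite /mscale/= mE affine_preimage_itv// lebesgue_measure_itv/=.
rewrite (lebesgue_measure_itv `](x - a) / c, (y - a) / c]%R)/=.
rewrite !lte_fin ltr_pM2r ?invr_gt0// ltrD2r.
case: ifPn => [xy|_]; last by rewrite mule0.
by rewrite -!EFinD -EFinM -mulrBl mulrC divfK ?gt_eqF// opprB addrA subrK.
Qed.

(** Induction on the dimension: the scaled image measure agrees with the product measure on
    rectangles, where one factor [c] goes to the first coordinate and [c ^+ n] to the others. *)
Lemma lebesgue_rV_affine n (a : 'rV[R]_n) (c : R) (A : set 'rV[R]_n) : (0 < c)%R ->
  measurable A ->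
  (c ^+ n)%:E * lebesgue_rV R n ((fun e => a + c *: e)%R @^-1` A) =
  lebesgue_rV R n A.
Proof.
move=> c0; elim: n a A => [|n IH] a A mA.
  rewrite expr0 mul1e; congr (lebesgue_rV R 0 _).
  by apply/seteqP; split => v; rewrite /= [(a + _)%R](_ : _ = v)//; apply/rowP; case.
pose b : 'rV[R]_n := \row_j a ord0 (lift ord0 j).
have mp := measurable_affine_rV b c.
pose phi (p : measurableTypeR R * 'rV[R]_n) : measurableTypeR R * 'rV[R]_n :=
  (a ord0 ord0 + c * p.1, b + c *: p.2)%R.
have mphi : measurable_fun setT phi.
  apply: measurable_fun_pair.
    exact: (measurableT_comp (measurable_affine _ _) measurable_fst).
  exact: (measurableT_comp mp measurable_snd).
have cn0 : (0 <= c ^+ n.+1)%R by rewrite exprn_ge0// ltW.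
have [m mE] := measure_image (leb \x lebesgue_rV R n) mphi.
have mA' : measurable (@rV_cons R n @^-1` A).
  by rewrite -[X in measurable X]setTI; exact: measurable_rV_cons.
rewrite /= /rV_product /pushforward.
have -> : (leb \x lebesgue_rV R n) (@rV_cons R n @^-1` A) =
    mscale (NngNum cn0) m (@rV_cons R n @^-1` A).
  apply: product_measure_unique => // B C mB mC; rewrite /= /mscale/= mE.
  have mB' : measurable ((fun e : R => a ord0 ord0 + c * e)%R @^-1` B).
    by rewrite -[X in measurable X]setTI; exact: measurable_affine.
  have mC' : measurable ((fun e => b + c *: e)%R @^-1` C).
    by rewrite -[X in measurable X]setTI; exact: mp.
  transitivity ((c ^+ n.+1)%:E * (
      leb ((fun e : R => a ord0 ord0 + c * e)%R @^-1` B) *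
      lebesgue_rV R n ((fun e => b + c *: e)%R @^-1` C))).
    by congr (_ * _); exact: (product_measure1E leb (lebesgue_rV R n) mB' mC').
  rewrite -(lebesgue_measure_affine (a ord0 ord0) c0 mB) -(IH b _ mC).
  by rewrite exprS EFinM muleACA.
transitivity ((c ^+ n.+1)%:E *
    (leb \x lebesgue_rV R n) (phi @^-1` (@rV_cons R n @^-1` A))); last first.
  by rewrite -mE.
(* The affine map acts coordinatewise, so it commutes with prepending a coordinate. *)
have E p : (a + c *: rV_cons p)%R = rV_cons (phi p).
  apply/rowP => i; rewrite !mxE; case: unliftP => [j|] -> /=; by rewrite ?mxE.
congr (_ * _); congr (product_measure1 _ _ _).
by apply/seteqP; split=> p; rewrite /= E.
Qed.

(** The left side is an integral against the image of Lebesgue measure, and that image is [c ^- n]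
    times Lebesgue measure. *)
Lemma ge0_integral_affine_rV n (a : 'rV[R]_n) (c : R) (A : set 'rV[R]_n)
    (f : 'rV[R]_n -> \bar R) : (0 < c)%R ->
  measurable A -> measurable_fun setT f -> (forall x, 0 <= f x) ->
  \int[lebesgue_rV R n]_(x in (fun e => a + c *: e)%R @^-1` A) f (a + c *: x)%R =
  (c ^- n)%:E * \int[lebesgue_rV R n]_(x in A) f x.
Proof.
move=> c0 mA mf f0.
have mp := measurable_affine_rV a c.
rewrite -(ge0_integral_pushforward mp)//; last exact: measurable_funTS.
have cn0 : (0 <= c ^- n)%R by rewrite invr_ge0 exprn_ge0// ltW.
rewrite -(ge0_integral_mscale (lebesgue_rV R n) mA (NngNum cn0))//.
apply: eq_measure_integral => B mB BA.
transitivity ((c ^- n)%:E * lebesgue_rV R n B); last by [].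
rewrite -(lebesgue_rV_affine a c0 mB) muleA -EFinM mulVf ?mul1e//.
  by rewrite expf_neq0// gt_eqF.
exact: measurable_funTS.
Qed.

End affine_change_of_variables.

(** * Isotropic Gaussian densities and their affine images *)

Section isotropic_gaussian.
Context {R : realType} {n : nat}.
Implicit Types (m x a : 'rV[R]_n) (c v : R).

Lemma gauss_pdf_scalar m v x :
  gauss_pdf m v%:M x = (Num.sqrt ((2 * pi) ^+ n * v ^+ n))^-1 *
    expR (- (v^-1 * \sum_(i < n) (x ord0 i - m ord0 i) ^+ 2) / 2).
Proof.
rewrite /gauss_pdf det_scalar invmx_scalar; congr (_ * expR _).
rewrite mulNr [RHS]mulNr; congr (- (_ * _)).
rewrite mul_mx_scalar -scalemxAl mxE; congr (_ * _).
by rewrite mxE; apply: eq_bigr => i _; rewrite !mxE expr2.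
Qed.

Lemma gauss_pdf_ge0 m (S : 'M[R]_n) x : 0 <= gauss_pdf m S x.
Proof. by rewrite mulr_ge0 ?expR_ge0// invr_ge0 sqrtr_ge0. Qed.

Lemma measurable_gauss_pdf m v : measurable_fun setT (gauss_pdf m v%:M).
Proof.
have mS : measurable_fun setT
    (fun x => \sum_(i < n) (rV_coord i x - m ord0 i) ^+ 2).
  apply: measurable_sum => i; apply: measurable_funX.
  exact: (measurable_funB (measurable_rV_coord i) (measurable_cst (m ord0 i))).
have mE := measurableT_comp (@measurable_expR R)
  (measurable_funM (measurable_cst (- (v^-1 / 2))) mS).
have mG := measurable_funM
  (measurable_cst (Num.sqrt ((2 * pi) ^+ n * v ^+ n))^-1) mE.
by apply: eq_measurable_fun mG => x _; rewrite gauss_pdf_scalar /= !mulNr mulrAC.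
Qed.

(** Squared distances and the variance both scale by [c ^+ 2], so the exponent is unchanged; only
    the normalizing constant contributes, with the square root of [(c ^+ 2) ^+ n]. *)
Lemma gauss_pdf_affine m v a c x : 0 < c ->
  gauss_pdf (a + c *: m) (c ^+ 2 * v)%:M (a + c *: x) =
  c ^- n * gauss_pdf m v%:M x.
Proof.
move=> c0; rewrite !gauss_pdf_scalar mulrA.
have -> : Num.sqrt ((2 * pi) ^+ n * (c ^+ 2 * v) ^+ n) =
    c ^+ n * Num.sqrt ((2 * pi) ^+ n * v ^+ n).
  rewrite (exprMn n (c ^+ 2) v) mulrCA -exprM mulnC exprM sqrtrM ?sqr_ge0//.
  by rewrite sqrtr_sqr ger0_norm// exprn_ge0// ltW.
rewrite invfM; congr (_ * expR (- _ / 2)).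
rewrite invfM -mulrA mulrCA; congr (_ * _); rewrite mulr_sumr.
apply: eq_bigr => i _; rewrite !mxE opprD addrACA subrr add0r -mulrBr exprMn.
by rewrite mulKf// expf_neq0// gt_eqF.
Qed.

Lemma has_density_gauss_affine {d} {T : measurableType d} (P : probability T R)
    (X : T -> 'rV[R]_n) m v a c : 0 < c ->
  has_density P X (gauss_pdf m v%:M) ->
  has_density P (fun w => a + c *: X w)
    (gauss_pdf (a + c *: m) (c ^+ 2 * v)%:M).
Proof.
move=> c0 [mX XE]; have mp := measurable_affine_rV a c.
split; first exact: (measurableT_comp mp mX).
move=> A mA.
have mA' : measurable ((fun e => a + c *: e) @^-1` A).
  by rewrite -[X in measurable X]setTI; exact: mp.
have mg := measurable_gauss_pdf (a + c *: m) (c ^+ 2 * v).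
have cn : c ^+ n != 0 by rewrite expf_neq0// gt_eqF.
have cn0 : 0 <= c ^+ n by rewrite exprn_ge0// ltW.
transitivity (P (X @^-1` ((fun e => a + c *: e) @^-1` A))) => //.
rewrite (XE _ mA').
have g0 y : (0 <= (gauss_pdf (a + c *: m) (c ^+ 2 * v)%:M y)%:E)%E.
  by rewrite lee_fin gauss_pdf_ge0.
have mEg := measurableT_comp (@EFin_measurable R setT) mg.
have mEf : measurable_fun ((fun e => a + c *: e) @^-1` A)
    (fun x => (gauss_pdf m v%:M x)%:E).
  apply/measurable_EFinP; apply: measurable_funTS.
  exact: measurable_gauss_pdf.
have E := ge0_integral_affine_rV a c0 mA mEg g0.
(* [E] and [K] evaluate the same integral, by change of variables and by scaling of the density.
   Each has the factor [c ^- n], which [cK] cancels in the extended reals. *)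
have K : (\int[lebesgue_rV R n]_(x in (fun e => a + c *: e)%R @^-1` A)
    (gauss_pdf (a + c *: m) (c ^+ 2 * v)%:M (a + c *: x)%R)%:E =
    (c ^- n)%:E * \int[lebesgue_rV R n]_(x in (fun e => a + c *: e)%R @^-1` A)
    (gauss_pdf m v%:M x)%:E)%E.
  under eq_integral do rewrite gauss_pdf_affine// EFinM.
  apply: (ge0_integralZl_EFin (lebesgue_rV R n) mA' _ mEf).
    by move=> x _; rewrite lee_fin gauss_pdf_ge0.
  by rewrite invr_ge0.
have cK (y : \bar R) : ((c ^+ n)%:E * ((c ^- n)%:E * y) = y)%E.
  by rewrite muleA -EFinM divff// mul1e.
have KE := congr1 (mule (c ^+ n)%:E) (etrans (esym K) E).
exact: (etrans (esym (cK _)) (etrans KE (cK _))).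
Qed.

End isotropic_gaussian.

(** * Conditional laws of functions of independent vectors *)

Section conditional_law.
Context {R : realType} {n : nat} {d : measure_display} {T : measurableType d}.
Context (P : probability T R) (X Y : T -> 'rV[R]_n).
Hypotheses (mX : measurable_fun setT X) (mY : measurable_fun setT Y).
Hypothesis XY : independent_vectors P X Y.
Local Open Scope ereal_scope.

(** By independence the joint law agrees with the product of the marginals on rectangles, hence
    everywhere; the product measure is by definition an integral of sections. *)
Lemma independent_prob_xsection (C : set ('rV[R]_n * 'rV[R]_n)) :
  measurable C ->
  P [set w | C (X w, Y w)] = \int[P]_w P (Y @^-1` xsection C (X w)).
Proof.
move=> mC.
pose mXM := isMeasurableFun.Build _ _ _ _ _ mX.
pose X' : {mfun _ >-> _} := HB.pack X mXM.
pose mYM := isMeasurableFun.Build _ _ _ _ _ mY.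
pose Y' : {mfun _ >-> _} := HB.pack Y mYM.
have [m mE] := measure_image P (measurable_fun_pair mX mY).
have := @product_measure_unique _ _ _ _ _ (distribution P X') (distribution P Y') m.
move=> /(_ _ _ mC); rewrite mE => <-.
  rewrite /product_measure1 ge0_integral_distribution//.
  exact: measurable_fun_xsection.
by move=> A B mA mB; rewrite mE; exact: XY.
Qed.

Lemma has_cond_density_indep (g : 'rV[R]_n * 'rV[R]_n -> 'rV[R]_n)
    (f : 'rV[R]_n -> 'rV[R]_n -> R) :
  measurable_fun setT g ->
  (forall x, has_density P (fun w => g (x, Y w)) (f x)) ->
  has_cond_density P X (fun w => g (X w, Y w)) f.
Proof.
move=> mg gf; split; first exact: (measurableT_comp mg (measurable_fun_pair mX mY)).
move=> A B mA mB.
have mC : measurable ((A `*` setT) `&` (g @^-1` B)).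
  apply: measurableI; first exact: measurableX.
  by rewrite -[X in measurable X]setTI; exact: mg.
have := independent_prob_xsection mC.
rewrite (_ : [set w | _] = X @^-1` A `&`
  (fun w => g (X w, Y w)) @^-1` B); last first.
  by apply/seteqP; split => w /=; [case=> -[]|case=> ? ?; split].
move=> ->; rewrite [RHS]integral_mkcond; apply: eq_integral => w _.
rewrite patchE; case: ifPn => [/set_mem|]; last rewrite notin_setE; move=> Aw.
  rewrite -(gf (X w)).2//; congr (P _); apply/seteqP.
  by split => v /=; [move/xsectionP => []|move=> ?; apply/xsectionP].
rewrite (_ : _ @^-1` _ = set0) ?measure0//; apply/seteqP; split => // v /=.
by move/xsectionP => -[[]] /Aw.
Qed.

End conditional_law.

(** * Derivatives of the Gaussian density in time and space *)

Section gaussian_derivatives.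
Context {R : realType} {n : nat}.

(* The density of N(m, s^2 I) at squared distance q from m. *)
Definition gauss_sd (s q : R) : R :=
  (Num.sqrt ((2 * pi) ^+ n))^-1 * s^-1 ^+ n * expR (- (1 / 2) * (s^-1 ^+ 2 * q)).

(** The sign of [s] gives the square root of [s ^+ 2] as [s]. The value [s = 0] is included, both
    sides following the convention that the inverse of 0 is 0. *)
Lemma gauss_pdf_sd s (m x : 'rV[R]_n) : 0 <= s ->
  gauss_pdf m (s ^+ 2)%:M x =
  gauss_sd s (\sum_(i < n) (x ord0 i - m ord0 i) ^+ 2).
Proof.
move=> s0; rewrite gauss_pdf_scalar /gauss_sd; congr (_ * expR _).
  rewrite -exprM mulnC exprM sqrtrM ?exprn_ge0 ?mulr_ge0 ?pi_ge0//.
  by rewrite sqrtr_sqr ger0_norm ?exprn_ge0// invfM exprVn.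
by rewrite exprVn !mulNr mul1r mulrC.
Qed.

(** The bracket is the logarithmic derivative. Moving [s] and [z] together covers both uses: the
    time derivative, and space derivatives with [s] constant. *)
Lemma is_derive_within_gauss_sd (I : set R) (s : R -> R) ds (z : 'I_n -> R -> R)
    dz t : s t != 0 -> is_derive_within I s t ds ->
  (forall i, is_derive_within I (z i) t (dz i)) ->
  is_derive_within I (fun h => gauss_sd (s h) (\sum_(i < n) z i h ^+ 2)) t
    (gauss_sd (s t) (\sum_(i < n) z i t ^+ 2) *
     (- n%:R * (ds / s t) + ds / s t ^+ 3 * (\sum_(i < n) z i t ^+ 2)
      - s t ^- 2 * \sum_(i < n) z i t * dz i)).
Proof.
move=> st0 sd zd.
have dQ := is_derive_within_sum (r := index_enum 'I_n)
  (fun i => is_derive_withinX (n := 2) (zd i)).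
have dr := is_derive_withinV st0 sd.
have drQ := is_derive_withinM (is_derive_withinX (n := 2) dr) dQ.
have dE := is_derive_within_comp
  (is_derive_withinM (is_derive_within_cst (V := R) I (- (1 / 2) : R) t) drQ)
  (is_derive_expR _).
have dK := is_derive_withinM
  (is_derive_within_cst (V := R) I (Num.sqrt ((2 * pi) ^+ n))^-1 t)
  (is_derive_withinX (n := n) dr).
have := is_derive_withinM dK dE; congr is_derive_within.
rewrite /gauss_sd /=.
set K := (Num.sqrt _)^-1; set Q := \sum_(i < n) z i t ^+ 2.
set e := expR _.
have -> : \sum_(i < n) 2 * z i t ^+ 1 * dz i = 2 * \sum_(i < n) z i t * dz i.
  by rewrite mulr_sumr; apply: eq_bigr => i _; rewrite expr1 mulrA.
set D := \sum_(i < n) z i t * dz i.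
(* Restores the power [n] in place of [n.-1], so that the density factors out; dimension 0 is
   treated apart. *)
have -> : n%:R * (s t)^-1 ^+ n.-1 * (- s t ^- 2 * ds) =
    - (n%:R * (s t)^-1 ^+ n * (ds / s t)).
  case: (n) => [|k] /=; first by rewrite !mul0r oppr0.
  by rewrite (exprS (s t)^-1 k); set rk := _ ^+ k; field.
by set rn := _ ^+ n; rewrite !exprVn; field.
Qed.

Lemma differentiable_bigsum {V W : normedModType R} {J : Type} (r : seq J)
    (f : J -> V -> W) x :
  (forall i, differentiable (f i) x) ->
  differentiable (fun y => \sum_(i <- r) f i y) x.
Proof.
move=> df; elim: r => [|i r IH].
  rewrite (_ : (fun y => _) = cst 0); first exact: differentiable_cst.
  by apply/funext => y; rewrite big_nil.
rewrite (_ : (fun y => _) = f i + (fun y => \sum_(j <- r) f j y)).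
  exact: differentiableD.
by apply/funext => y; rewrite big_cons.
Qed.

(** A differentiable function of one variable composed with the squared distance, a polynomial in
    the coordinates. *)
Lemma differentiable_gauss_pdf (m : 'rV[R]_n) s x :
  0 <= s -> differentiable (gauss_pdf m (s ^+ 2)%:M) x.
Proof.
move=> s0.
rewrite (_ : gauss_pdf _ _ = (fun q => gauss_sd s q) \o
    (fun y => \sum_(i < n) (y ord0 i - m ord0 i) ^+ 2)); last first.
  by apply/funext => y; rewrite gauss_pdf_sd.
apply: differentiable_comp.
  apply: differentiable_bigsum => i.
  apply: (@differentiableX _ _ (fun y : 'rV[R]_n => y ord0 i - m ord0 i) 1).
  by apply: differentiableB => //; exact: differentiable_coord.
set q := (q in differentiable _ q).
have did : is_derive_within setT (@id R) q 1 by apply/is_derive_withinT.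
have dcst k := is_derive_within_cst (V := R) setT k q.
have dE := is_derive_within_comp
  (is_derive_withinM (dcst (- (1 / 2))) (is_derive_withinM (dcst (s^-1 ^+ 2)) did))
  (is_derive_expR _).
have /is_derive_withinT [/derivable1_diffP] := is_derive_withinM
  (dcst ((Num.sqrt ((2 * pi) ^+ n))^-1 * s^-1 ^+ n)) dE.
exact.
Qed.

Lemma differentiable_gauss_pdfZ (m b x : 'rV[R]_n) s k : 0 <= s ->
  differentiable (fun y => gauss_pdf m (s ^+ 2)%:M y *: (b + k *: y)) x.
Proof.
move=> s0.
rewrite (_ : (fun y => _) = fun y => \sum_(i < n)
    (gauss_pdf m (s ^+ 2)%:M y * (b ord0 i + k * y ord0 i)) *: delta_mx 0 i).
  apply: differentiable_bigsum => i; apply: differentiableZl.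
  apply: differentiableM; first exact: differentiable_gauss_pdf.
  apply: differentiableD => //.
  by apply: differentiableM => //; exact: differentiable_coord.
apply/funext => y; rewrite [LHS]row_sum_delta.
by apply: eq_bigr => i _; rewrite !mxE.
Qed.

(** One summand of the divergence of density times affine field. On the line through [x] in
    direction [i], only coordinate [i] moves, so the sum in the logarithmic derivative keeps a
    single term. *)
Lemma is_derive_gauss_pdfM (m b x : 'rV[R]_n) s k i : 0 < s ->
  is_derive x (delta_mx ord0 i : 'rV[R]_n)
    (fun y => (gauss_pdf m (s ^+ 2)%:M y *: (b + k *: y)) ord0 i)
    (gauss_pdf m (s ^+ 2)%:M x *
      (k - s ^- 2 * (x ord0 i - m ord0 i) * (b ord0 i + k * x ord0 i))).
Proof.
move=> s0; apply: is_derive_line.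
pose y h : 'rV[R]_n := h *: delta_mx ord0 i + x.
have dy j : is_derive_within setT (fun h => y h ord0 j) 0 (j == i)%:R.
  rewrite (_ : (fun h => _) = fun h => h * (j == i)%:R + x ord0 j); last first.
    by apply/funext => h; rewrite !mxE eqxx.
  have did : is_derive_within setT (@id R) 0 1 by apply/is_derive_withinT.
  have := is_derive_withinD
    (is_derive_withinM did (is_derive_within_cst setT ((j == i)%:R : R) 0))
    (is_derive_within_cst setT (x ord0 j) 0).
  by rewrite mul1r mulr0 !addr0.
have ds := is_derive_within_cst setT (s : R) 0.
have dg := is_derive_within_gauss_sd (lt0r_neq0 s0) ds (fun j =>
  is_derive_withinD (dy j) (is_derive_within_cst setT (- m ord0 j) 0)).
have du := is_derive_withinD (is_derive_within_cst setT (b ord0 i) 0)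
  (is_derive_withinM (is_derive_within_cst setT (k : R) 0) (dy i)).
have := is_derive_withinM dg du.
rewrite (_ : (fun h => _) = fun h =>
  (gauss_pdf m (s ^+ 2)%:M (y h) *: (b + k *: y h)) ord0 i); last first.
  by apply/funext => h; rewrite gauss_pdf_sd ?ltW// !mxE.
rewrite -gauss_pdf_sd ?ltW//.
congr is_derive_within.
rewrite /y scale0r add0r eqxx !mul0r mulr0 mulr1 !add0r.
rewrite (bigD1 i)//= eqxx big1 => [|j /negbTE ->]; last by rewrite addr0 mulr0.
by rewrite !addr0 mulr1; ring.
Qed.

End gaussian_derivatives.

(** * The flow of the conditional velocity and the continuity equation *)

Section gaussian_path_ode.
Context {R : realType} {n : nat} (alpha sigma : R -> R).
Hypothesis hs : is_schedule alpha sigma.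

Local Notation I01 := `[0 : R, 1]%classic.
Local Notation dalpha t := (derive_within I01 alpha t).
Local Notation dsigma t := (derive_within I01 sigma t).
Local Notation u := (cond_velocity alpha sigma).

Let nondeg_I01 t : nondegenerate_times sigma t -> I01 t.
Proof. by case. Qed.

Let alpha_drv t : nondegenerate_times sigma t ->
  is_derive_within I01 alpha t (dalpha t).
Proof. by case=> t01 _; exact: (schedule_derivable_alpha hs). Qed.

Let sigma_drv t : nondegenerate_times sigma t ->
  is_derive_within I01 sigma t (dsigma t).
Proof. by case=> t01 _; exact: (schedule_derivable_sigma hs). Qed.

Definition cond_flow (x0 y : 'rV[R]_n) (s t : R) : 'rV[R]_n :=
  alpha t *: x0 + (sigma t / sigma s) *: (y - alpha s *: x0).

(** Existence: the velocity is [dalpha] times [x0] plus [dsigma / sigma] times the deviation from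
    [alpha t *: x0], and along the flow that deviation is proportional to [sigma t]. *)
Lemma cond_flow_solves (J : set R) (x0 y : 'rV[R]_n) s :
  J `<=` nondegenerate_times sigma -> solves_ode J (u x0) (cond_flow x0 y s).
Proof.
move=> JI t Jt; have It := JI _ Jt.
have st : sigma t != 0 by case: It => _ /lt0r_neq0.
have JI01 : J `<=` I01 by move=> r /JI /nondeg_I01.
have da := is_derive_within_subset JI01 (alpha_drv It).
have ds := is_derive_within_subset JI01 (sigma_drv It).
have dax := is_derive_withinZ da (is_derive_within_cst J x0 t).
have dsk := is_derive_withinM ds (is_derive_within_cst J (sigma s)^-1 t).
have dsx := is_derive_withinZ dsk (is_derive_within_cst J (y - alpha s *: x0) t).
have := is_derive_withinD dax dsx; rewrite !scaler0 !mulr0 !addr0.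
congr is_derive_within.
rewrite /cond_velocity /cond_flow [in RHS]scalerDr addrA; congr (_ + _).
  by rewrite scalerA -scalerDl subrK.
by rewrite [in RHS]scalerA mulrA divfK.
Qed.

(** Uniqueness: the standardized deviation [z] is constant along any solution, so the state at time
    [s] determines the state at time [t]. *)
Lemma solves_ode_cond_flow (J : set R) (x0 : 'rV[R]_n) (x : R -> 'rV[R]_n) s t :
  is_interval J -> J `<=` nondegenerate_times sigma -> solves_ode J (u x0) x ->
  J s -> J t -> x t = cond_flow x0 (x s) s t.
Proof.
move=> Jitv JI ode Js Jt.
have JI01 : J `<=` I01 by move=> r /JI /nondeg_I01.
have s0 r : J r -> sigma r != 0 by move=> /JI [_ /lt0r_neq0].
pose z r := (sigma r)^-1 *: (x r - alpha r *: x0).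
have dz r : J r -> is_derive_within J z r 0.
  move=> Jr; have Ir := JI _ Jr; have sr := s0 _ Jr.
  have da := is_derive_within_subset JI01 (alpha_drv Ir).
  have ds := is_derive_within_subset JI01 (sigma_drv Ir).
  have dax := is_derive_withinZ da (is_derive_within_cst J x0 r).
  have dNax := is_derive_withinZ (is_derive_within_cst (V := R) J (-1) r) dax.
  have dxa := is_derive_withinD (ode _ Jr) dNax.
  have dV := is_derive_withinV sr ds.
  have := is_derive_withinZ dV dxa.
  rewrite /z (_ : (fun r => _ *: _) =
    fun r => (sigma r)^-1 *: (x r - alpha r *: x0)); last first.
    by apply/funext => r'; rewrite scaleN1r.
  congr is_derive_within.
  apply/rowP => i; rewrite /cond_velocity !mxE.
  by field.
have zE : z s = z t.
  apply/rowP => i.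
  apply: (is_derive_within0_cst Jitv (f := fun r => z r ord0 i)) => // r Jr.
  have /= := is_derive_within_coord (i := i) (dz _ Jr); rewrite mxE; exact.
by rewrite /cond_flow -scalerA -/(z s) zE /z scalerA divff ?s0// scale1r addrC subrK.
Qed.

Lemma generated_by_ode_gaussian (x0 : 'rV[R]_n) :
  generated_by_ode (nondegenerate_times sigma) (u x0) (cond_path alpha sigma x0).
Proof.
move=> J Jitv JI s Js; split => [y|d T P X ode Xs t Jt].
  exists (cond_flow x0 y s); first exact: cond_flow_solves.
  have [_ /lt0r_neq0 sn] := JI _ Js.
  by rewrite /cond_flow (divff sn) scale1r [LHS]addrC subrK.
have [[_ s0] [_ t0]] := (JI _ Js, JI _ Jt).
have sn : sigma s != 0 by rewrite gt_eqF.
(* The flow is put in the form shift plus positive multiple of [X s]; the shift is chosen so that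
   the mean [alpha s *: x0] goes to [alpha t *: x0]. *)
have -> : X t = fun w => (alpha t *: x0 - (sigma t / sigma s * alpha s) *: x0) +
    (sigma t / sigma s) *: X s w.
  apply/funext => w; rewrite (solves_ode_cond_flow Jitv JI (ode w) Js Jt) /cond_flow.
  by rewrite scalerBr scalerA -addrA; congr (_ + _); rewrite addrC.
have := has_density_gauss_affine
  (alpha t *: x0 - (sigma t / sigma s * alpha s) *: x0) (divr_gt0 t0 s0) Xs.
by rewrite /cond_path scalerA subrK -exprMn divfK.
Qed.

Lemma continuity_equation_gaussian (x0 : 'rV[R]_n) :
  continuity_equation (nondegenerate_times sigma) (u x0) (cond_path alpha sigma x0).
Proof.
move=> t x It; have [t01 st] := It.
set b := (dalpha t - dsigma t / sigma t * alpha t) *: x0.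
set k := dsigma t / sigma t.
split; first exact: (differentiable_gauss_pdfZ (alpha t *: x0) b x k (ltW st)).
pose z i r := x ord0 i - (alpha r *: x0) ord0 i.
have dz i : is_derive_within I01 (z i) t (- (dalpha t * x0 ord0 i)).
  have dax := is_derive_withinM (alpha_drv It)
    (is_derive_within_cst I01 (x0 ord0 i) t).
  have := is_derive_withinD (is_derive_within_cst I01 (x ord0 i) t)
    (is_derive_withinM (is_derive_within_cst I01 (-1 : R) t) dax).
  rewrite mulr0 addr0 mul0r !add0r mulN1r; congr is_derive_within.
  by apply/funext => r; rewrite /z mxE mulN1r.
have := is_derive_within_gauss_sd (lt0r_neq0 st) (sigma_drv It) dz.
move=> /(eq_is_derive_within (I := I01) (g := cond_path alpha sigma x0 ^~ x) t01) H.
(* The time derivative is taken within all of [[0, 1]], so the two expressions must agree also where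
   [sigma] vanishes, for instance at 0. *)
have /H : forall r, I01 r ->
    gauss_sd (n := n) (sigma r) (\sum_(i < n) z i r ^+ 2) =
    cond_path alpha sigma x0 r x.
  by move=> r r01; rewrite /cond_path gauss_pdf_sd//; exact: (schedule_sigma_ge0 hs).
congr is_derive_within; rewrite /divergence.
(* The [i]-th term of the divergence with the density factored out; what remains is to compare the
   time logarithmic derivative with minus the sum of the [c i]. *)
pose c i := k - sigma t ^- 2 * z i t * (b ord0 i + k * x ord0 i).
transitivity (- \sum_(i < n)
    gauss_sd (n := n) (sigma t) (\sum_(i < n) z i t ^+ 2) * c i); last first.
  congr (- _); apply: eq_bigr => i _; rewrite -gauss_pdf_sd ?ltW//; apply/esym.
  by rewrite (@derive_val _ _ _ _ _ _ _
    (is_derive_gauss_pdfM (alpha t *: x0) b x k i st)).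
rewrite -mulr_sumr -[RHS]mulrN; congr (_ * _).
rewrite sumrB sumr_const card_ord opprB addrC -mulr_natl.
(* Coordinate [i] of the velocity is [dalpha t * x0 ord0 i + k * z i t], which separates the
   quadratic term from the cross term. *)
have -> : \sum_(i < n) sigma t ^- 2 * z i t * (b ord0 i + k * x ord0 i) =
    k / sigma t ^+ 2 * (\sum_(i < n) z i t ^+ 2)
    - sigma t ^- 2 * \sum_(i < n) z i t * - (dalpha t * x0 ord0 i).
  rewrite !mulr_sumr -sumrB; apply: eq_bigr => i _.
  rewrite /k /z /b !mxE; field; exact: lt0r_neq0.
rewrite /k; field; exact: lt0r_neq0.
Qed.

End gaussian_path_ode.

(** * Assembly of the conditional law, the flow and the continuity equation *)

Lemma measurable_rV_lincomb {R : realType} {n : nat} (a c : R) :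
  measurable_fun setT (fun p : 'rV[R]_n * 'rV[R]_n => a *: p.1 + c *: p.2).
Proof.
apply: measurable_fun_rV => i.
have m1 := measurableT_comp (measurable_rV_coord i)
  (@measurable_fst _ _ 'rV[R]_n 'rV[R]_n).
have m2 := measurableT_comp (measurable_rV_coord i)
  (@measurable_snd _ _ 'rV[R]_n 'rV[R]_n).
have := measurable_funD (measurable_funM (measurable_cst a) m1)
  (measurable_funM (measurable_cst c) m2).
by apply: eq_measurable_fun => p _; rewrite /rV_coord /= !mxE.
Qed.

Theorem theorem1p2 (R : realType) (n : nat) (alpha sigma : R -> R)
    (hs : is_schedule alpha sigma) :
  (forall (d : measure_display) (T : measurableType d) (P : probability T R)
      (X0 eps : T -> 'rV[R]_n),
    measurable_fun setT X0 -> has_density P eps (gauss_pdf 0 1%:M) ->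
    independent_vectors P X0 eps ->
    forall t, nondegenerate_times sigma t ->
      has_cond_density P X0 (fun w => alpha t *: X0 w + sigma t *: eps w)
        (fun x0 => cond_path alpha sigma x0 t)) /\
  (forall x0 : 'rV[R]_n,
    generated_by_ode (nondegenerate_times sigma)
      (cond_velocity alpha sigma x0) (cond_path alpha sigma x0) /\
    continuity_equation (nondegenerate_times sigma)
      (cond_velocity alpha sigma x0) (cond_path alpha sigma x0)).
Proof.
split=> [d T P X0 eps mX0 epsd indep t [_ st]|x0].
  apply: (has_cond_density_indep mX0 epsd.1 indep
    (g := fun p => alpha t *: p.1 + sigma t *: p.2)).
    exact: measurable_rV_lincomb.
  (* With [X0] frozen at [x], the vector is an affine image of standard noise: mean
     [alpha t *: x + sigma t *: 0] and variance [sigma t ^+ 2 * 1]. *)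
  move=> x; have := has_density_gauss_affine (alpha t *: x) st epsd.
  by rewrite scaler0 addr0 mulr1.
split; first exact: generated_by_ode_gaussian.
exact: continuity_equation_gaussian.
Qed.
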